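(* Let $S\subseteq\mathbb{Z}^+$. Then $$\sum_{n\ge 0}|\mathrm{UPF}^{\mathrm{T1}}_{n,S}|\frac{x^n}{n!}=\sum_{k\in S}(e^x-1)^k$$ as formal power series.
   Context: A parking preference $(a_1,\dots,a_n)\in[n]^n$ describes $n$ cars entering a one-way street with spots $1,\dots,n$ in the order $1,2,\dots,n$; car $i$ parks in the first unoccupied spot numbered $\ge a_i$. It is a parking function if all cars park. It is a unit interval parking function if it is a parking function and every car $i$ parks in spot $a_i$ or spot $a_i+1$. Car $i$ is lucky if it parks in spot $a_i$. $\mathrm{UPF}^{\mathrm{T1}}_{n,S}$ is the set of unit interval parking functions of length $n$ whose number of lucky cars belongs to $S$. For $n=0$, the only unit interval parking function is the empty tuple. It has $0$ lucky cars, so $|\mathrm{UPF}^{\mathrm{T1}}_{0,S}|=0$ when $S\subseteq\mathbb{Z}^+$. *)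

(* Defs.v *)
From HB Require Import structures.
From mathcomp Require Import all_boot all_order all_algebra.
From mathcomp Require Import boolp classical_sets functions cardinality fsbigop.

Set Implicit Arguments.
Unset Strict Implicit.
Unset Printing Implicit Defensive.

Import GRing.Theory.
Local Open Scope ring_scope.

(* Cars and spots are indexed from 0: the ordinal j : 'I_n stands for spot
   (or car) j + 1, and the tuple p for the preference (p_0 + 1, ..). *)

Section Parking.
Variable n : nat.
Implicit Types (occ : seq 'I_n) (p : n.-tuple 'I_n) (i : 'I_n).

(* [enum 'I_n] is increasing, so the head of the filtered list is the first
   free spot; None means that the car leaves the street without parking. *)
Definition first_free occ (a : 'I_n) : option 'I_n :=
  ohead [seq s : 'I_n <- enum 'I_n | (a <= s)%N && (s \notin occ)].

Fixpoint park_from occ (prefs : seq 'I_n) : seq (option 'I_n) :=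
  if prefs is a :: prefs' then
    let o := first_free occ a in
    o :: park_from (if o is Some s then s :: occ else occ) prefs'
  else [::].

Definition spot_of p i : option 'I_n := nth None (park_from [::] p) i.

Definition parking_function p : bool := [forall i, isSome (spot_of p i)].

Definition unit_interval_pf p : bool :=
  parking_function p &&
  [forall i, exists s : 'I_n, (spot_of p i == Some s) &&
     ((s == tnth p i :> nat) || (s == (tnth p i).+1 :> nat))].

Definition lucky p i : bool := spot_of p i == Some (tnth p i).

Definition nb_lucky p : nat := #|[pred i | lucky p i]|.

End Parking.

Definition UPF_T1 (n : nat) (S : set nat) : {set n.-tuple 'I_n} :=
  [set p : n.-tuple 'I_n | unit_interval_pf p && (nb_lucky p \in S)]%SET.

(* Formal power series over the rationals, given by their coefficients. The
   product is the Cauchy product, not the pointwise product of functions. *)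
Definition fps : Type := nat -> rat.

Definition fps_one : fps := fun n => (n == 0%N)%:R.

Definition fps_sub (f g : fps) : fps := fun n => f n - g n.

Definition fps_mul (f g : fps) : fps :=
  fun n => \sum_(i < n.+1) f i * g (n - i)%N.

Definition fps_pow (f : fps) (k : nat) : fps := iter k (fps_mul f) fps_one.

Definition fps_expx : fps := fun n => (n`!%:R)^-1.

Definition egf (c : nat -> nat) : fps := fun n => (c n)%:R / n`!%:R.

(* A family is summable when each coefficient is nonzero in only finitely many
   members. Without summability, fps_sum takes the default value 0 at the
   coefficients with infinitely many nonzero contributions. *)
Definition fps_summable (S : set nat) (F : nat -> fps) : Prop :=
  forall n, finite_set [set k | S k /\ F k n <> 0]%classic.

Definition fps_sum (S : set nat) (F : nat -> fps) : fps :=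
  fun n => \sum_(k \in S) F k n.

(* Main.v *)
Require Import Defs.
From HB Require Import structures.
From mathcomp Require Import all_boot all_order all_algebra.
From mathcomp Require Import boolp classical_sets functions cardinality fsbigop.
From mathcomp Require Import fintype finset ring zify.

Set Implicit Arguments.
Unset Strict Implicit.
Unset Printing Implicit Defensive.

Import GRing.Theory.

(** A unit interval parking function is determined by its outcome (the
    permutation sending a car to its spot) and by the set of lucky cars; the
    only constraint is that an unlucky car parks right after the spot of an
    earlier car. Cutting the street before each lucky car therefore yields
    blocks inside which the cars are parked in order of arrival, so that unit
    interval parking functions of length [n] with [k] lucky cars correspond to
    surjections from cars to [k] blocks, i.e. to words of length [n] using all
    letters of a [k]-letter alphabet; the outcome is the standardization of the
    word. The numbers of such words satisfy
    [w (n+1) k = k (w n k + w n (k-1))], by removing the first letter. With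
    [E = e^x - 1] this is the coefficient form of
    [(E^k)' = k (E^k + E^(k-1))]. *)

(** * First free spots and parking outcomes *)

Lemma sorted_ohead_filterP (T : eqType) (r : rel T) (P : pred T) (s : seq T) x :
    transitive r -> irreflexive r -> sorted r s ->
  ohead (filter P s) = Some x <->
  [/\ x \in s, P x & forall y, y \in s -> r y x -> ~~ P y].
Proof.
move=> r_tr r_irr; elim: s => [|z s IHs] /=; first by split=> // -[].
rewrite path_sortedE// => /andP[/allP zs /IHs{}IHs].
have [Pz|nPz] := boolP (P z); split => /=.
- case=> <-; split=> //; first exact: mem_head.
  move=> y; rewrite inE => /predU1P[-> | /zs zy yz]; first by rewrite r_irr.
  by have := r_tr _ _ _ zy yz; rewrite r_irr.
- case; rewrite inE => /predU1P[-> // | /zs zx] _ /(_ z (mem_head _ _) zx).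
  by rewrite Pz.
- move/IHs=> [xs Px minx]; split=> //; first by rewrite inE xs orbT.
  by move=> y; rewrite inE => /predU1P[-> // | /minx].
- rewrite inE => -[/predU1P[-> | xs] Px minx]; first by rewrite Px in nPz.
  by apply/IHs; split=> // y ys; apply: minx; rewrite inE ys orbT.
Qed.

Lemma first_freeP n (occ : seq 'I_n) (a s : 'I_n) :
  first_free occ a = Some s <->
  [/\ a <= s, s \notin occ & forall t : 'I_n, a <= t < s -> t \in occ].
Proof.
have srt : sorted (fun i j : 'I_n => i < j) (enum 'I_n).
  by have := iota_ltn_sorted 0 n; rewrite -val_enum_ord sorted_map.
have tr : transitive (fun i j : 'I_n => i < j) by move=> j i k; apply: ltn_trans.
have irr : irreflexive (fun i j : 'I_n => i < j) by move=> i; apply: ltnn.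
rewrite /first_free (sorted_ohead_filterP _ _ tr irr srt).
split.
  case=> _ /andP[as_ socc] mins; split=> // t /andP[at_ ts].
  by have := mins t (mem_enum _ _) ts; rewrite at_ /= negbK.
case=> as_ socc mins; split; rewrite ?mem_enum ?as_ // => t _ ts.
by apply/negP => /andP[at_]; apply/negP; rewrite negbK mins// at_.
Qed.

Section Outcome.
Variable n : nat.
Implicit Types (occ : seq 'I_n) (p : n.-tuple 'I_n) (i j s t : 'I_n).

Lemma size_park_from occ prefs : size (park_from occ prefs) = size prefs.
Proof. by elim: prefs occ => //= a prefs IH occ; rewrite IH. Qed.

(** [catrev] appears because [park_from] pushes each new spot onto the front of the list, and
    [pmap id] drops the cars that failed to park. *)
Lemma nth_park_from occ prefs i0 k : k < size prefs ->
  nth None (park_from occ prefs) k =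
  first_free (catrev (pmap id (take k (park_from occ prefs))) occ)
             (nth i0 prefs k).
Proof.
elim: prefs occ k => //= a prefs IH occ [|k] //= lt_k.
by rewrite IH//; case: (first_free occ a).
Qed.

(** Trades the list of occupied spots for the outcomes of earlier cars, the form in which all later
    arguments use the parking rule. *)
Lemma spot_ofP p i s : spot_of p i = Some s <->
  [/\ tnth p i <= s, forall j, j < i -> spot_of p j <> Some s
    & forall t, tnth p i <= t < s -> exists2 j : 'I_n, j < i & spot_of p j = Some t].
Proof.
rewrite {1}/spot_of (nth_park_from _ i) ?size_tuple// -tnth_nth.
set occ := catrev _ _.
have occP t : t \in occ <-> exists2 j : 'I_n, j < i & spot_of p j = Some t.
  rewrite /occ catrevE cats0 mem_rev mem_pmap map_id; split.
    move=> /(nthP None)[k]; rewrite size_take size_park_from size_tuple ltn_ord.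
    move=> lt_ki; rewrite nth_take// => nthk.
    by exists (Ordinal (ltn_trans lt_ki (ltn_ord i))).
  move=> [j lt_ji <-]; rewrite /spot_of -(nth_take None lt_ji).
  by rewrite mem_nth// size_take size_park_from size_tuple ltn_ord.
rewrite first_freeP; split.
  case=> ps socc mins; split=> // [j lt_ji pj|t /mins/occP//].
  by move/negP: socc; apply; apply/occP; exists j.
case=> ps socc mins; split=> // [|t /mins/occP//].
by apply/negP => /occP[j lt_ji]; apply: socc.
Qed.

(** A certificate that avoids running the parking process: an earlier car on the preferred spot is
    what forces a car one spot further. *)
Definition unit_outcome p (sigma : 'I_n -> 'I_n) : Prop :=
  injective sigma /\
  forall i, sigma i = tnth p i \/
    (sigma i = (tnth p i).+1 :> nat /\
     exists2 j : 'I_n, j < i & sigma j = tnth p i).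

(** Strong induction on the arrival order: injectivity keeps [sigma i] free, and the only spot that
    car [i] may have to skip is its preference, already taken. *)
Lemma unit_outcome_spot p sigma : unit_outcome p sigma ->
  forall i, spot_of p i = Some (sigma i).
Proof.
move=> [inj_s unit_s] i; have [m] := ubnP i; elim: m i => // m IH i le_im.
have IHi j : j < i -> spot_of p j = Some (sigma j).
  by move=> lt_ji; apply: IH; apply: leq_trans lt_ji le_im.
apply/spot_ofP; split.
- by case: (unit_s i) => [->|[-> _]].
- by move=> j lt_ji; rewrite IHi// => -[/inj_s eq_ji]; rewrite eq_ji ltnn in lt_ji.
- move=> t /andP[pt ts]; case: (unit_s i) => [si|[si [j lt_ji sj]]].
    by rewrite si ltnNge pt in ts.
  exists j => //; rewrite IHi// sj; congr Some; apply: val_inj.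
  by apply/eqP; rewrite eqn_leq pt -ltnS -si.
Qed.

Lemma unit_interval_pfP p :
  unit_interval_pf p <-> exists sigma, unit_outcome p sigma.
Proof.
split=> [/andP[_ /forallP unit_p] | [sigma out]]; last first.
  have spot := unit_outcome_spot out.
  apply/andP; split; apply/forallP => i; first by rewrite spot.
  apply/existsP; exists (sigma i); rewrite spot eqxx /=.
  by case: (out.2 i) => [-> | [-> _]]; rewrite eqxx ?orbT.
(* The default [i] is never reached, since every car parks. *)
pose sigma i := odflt i (spot_of p i).
have spot i : spot_of p i = Some (sigma i).
  by rewrite /sigma; have /existsP[s /andP[/eqP-> _]] := unit_p i.
have inj_s : injective sigma.
  suff lt_neq i j : i < j -> sigma i <> sigma j.
    move=> i j eq_ij; apply: val_inj; case: (ltngtP i j) => // lt_ij.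
      by case: (lt_neq _ _ lt_ij).
    by case: (lt_neq _ _ lt_ij).
  move=> lt_ij eq_ij; have /spot_ofP[_ /(_ i lt_ij) + _] := spot j.
  by rewrite spot eq_ij.
exists sigma; split=> // i.
have /existsP[s /andP[/eqP]] := unit_p i; rewrite spot => -[<-].
case/orP=> /eqP si; [by left; apply: val_inj | right; split=> //].
have /spot_ofP[_ _ /(_ (tnth p i))] := spot i.
rewrite si leqnn ltnSn => /(_ isT)[j lt_ji]; rewrite spot => -[<-].
by exists j.
Qed.

Lemma unit_outcome_lucky p sigma : unit_outcome p sigma ->
  lucky p =1 fun i => sigma i == tnth p i.
Proof. by move=> out i; rewrite /lucky (unit_outcome_spot out). Qed.

End Outcome.

(** * Derivatives of the powers of e^x - 1 *)

Section Series.
Local Open Scope ring_scope.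

Definition fps_deriv (f : fps) : fps := fun n => n.+1%:R * f n.+1.

(** The factor [n.+1] splits as [i + (n.+1 - i)]; the first half loses its term [i = 0], the second
    its term [i = n.+1]. *)
Lemma fps_deriv_mul f g n :
  fps_deriv (fps_mul f g) n =
  fps_mul (fps_deriv f) g n + fps_mul f (fps_deriv g) n.
Proof.
rewrite /fps_deriv /fps_mul.
transitivity (\sum_(i < n.+2) (i%:R * f i * g (n.+1 - i)%N +
                 f i * ((n.+1 - i)%:R * g (n.+1 - i)%N))).
  rewrite mulr_sumr; apply: eq_bigr => i _.
  have -> : n.+1%:R = i%:R + (n.+1 - i)%:R :> rat by rewrite -natrD subnKC// leq_ord.
  ring.
rewrite big_split /=; congr (_ + _).
  by rewrite big_ord_recl /= !mul0r add0r; apply: eq_bigr => i _; rewrite subSS.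
rewrite big_ord_recr /= subnn mul0r mulr0 addr0; apply: eq_bigr => i _.
by rewrite subSn// leq_ord.
Qed.

Local Notation E := (fps_sub fps_expx fps_one).

Lemma fps_deriv_expx_sub1 n : fps_deriv E n = E n + fps_one n.
Proof.
rewrite /fps_deriv /fps_sub /fps_expx /fps_one /= subr0 subrK factS natrM.
by rewrite invfM mulVKf// Num.Theory.pnatr_eq0.
Qed.

Lemma fps_mul1 g n : fps_mul fps_one g n = g n.
Proof.
rewrite /fps_mul big_ord_recl /= subn0 /fps_one eqxx mul1r big1 ?addr0// => i _.
by rewrite /= mul0r.
Qed.

Lemma fps_pow_expx_sub1_rec k n :
  n.+1%:R * fps_pow E k.+1 n.+1 =
  k.+1%:R * (fps_pow E k.+1 n + fps_pow E k n).
Proof.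
have derivS k' m : fps_deriv (fps_pow E k'.+1) m =
    fps_pow E k'.+1 m + fps_pow E k' m
    + fps_mul E (fps_deriv (fps_pow E k')) m.
  rewrite [fps_pow E k'.+1]/(fps_mul E (fps_pow E k')) fps_deriv_mul.
  congr (_ + _); rewrite -[X in _ + X]fps_mul1 /fps_mul -big_split /=.
  by apply: eq_bigr => i _; rewrite fps_deriv_expx_sub1 mulrDl.
elim: k n => [|k IH] n; rewrite -[LHS]/(fps_deriv _ _) derivS.
  rewrite mul1r /fps_mul big1 ?addr0// => i _.
  by rewrite /fps_deriv /= /fps_one mulr0 mulr0.
set a := fps_pow _ k.+2 n; set b := fps_pow _ k.+1 n.
(* The induction hypothesis for the derivative of E^(k+1), multiplied by E. *)
have -> : fps_mul E (fps_deriv (fps_pow E k.+1)) n = k.+1%:R * (a + b).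
  rewrite /a /b [fps_pow E k.+2]/(fps_mul E (fps_pow E k.+1)).
  rewrite [in X in _ + X]/= -/(fps_pow E k) /fps_mul -big_split mulr_sumr /=.
  by apply: eq_bigr => i _; rewrite /fps_deriv IH mulrCA mulrDr.
ring.
Qed.

End Series.

(** * Counting words that use every letter *)

Section Words.
Variable T : finType.
Implicit Type A : {set T}.

(** The alphabet is a subset of a fixed type, so that deleting a letter in the recurrence does not
    change the type. *)
Definition words_onto n A : {set n.-tuple T} := [set t : n.-tuple T | [set x in t] == A].

(** Split off the first letter [x]: the remaining word uses all of [A] if [x] occurs again, and
    [A :\ x] otherwise. *)
Lemma card_words_ontoS n A :
  #|words_onto n.+1 A| =
  \sum_(x in A) (#|words_onto n A| + #|words_onto n (A :\ x)|).
Proof.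
have cardE m B : #|words_onto m B| = \sum_(t : m.-tuple T) ([set x in t] == B).
  by rewrite -sum1_card big_mkcond; apply: eq_bigr => t _; rewrite inE; case: eqP.
rewrite cardE (reindex (fun u : T * n.-tuple T => [tuple of u.1 :: u.2])) /=; last first.
  exists (fun t : n.+1.-tuple T => (thead t, [tuple of behead t])) => [[x t] _|t _].
    by congr (_, _); apply: val_inj.
  by rewrite [RHS]tuple_eta; apply: val_inj.
rewrite -(pair_bigA _ (fun x (t : n.-tuple T) =>
  ([set y in x :: t] == A : nat))) /= [RHS]big_mkcond.
apply: eq_bigr => x _; rewrite !cardE -big_split /=.
case: ifPn => [xA|xnA]; last first.
  apply: big1 => t _; case: eqP => // tA.
  by rewrite -tA inE mem_head in xnA.
apply: eq_bigr => t _; rewrite set_cons; set B := [set y in t].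
have [xB|xnB] := boolP (x \in B).
  have /setUidPr-> : [set x] \subset B by rewrite sub1set.
  rewrite [B == A :\ x](_ : _ = false) ?addn0//.
  by apply/eqP => eB; rewrite eB setD11 in xB.
rewrite [B == A](_ : _ = false) ?add0n; last first.
  by apply/eqP => eB; rewrite eB xA in xnB.
congr (nat_of_bool _); apply/eqP/eqP => [<-|->]; first by rewrite setU1K.
by rewrite setD1K.
Qed.

(** Both sides obey the same recurrence in [n], by [card_words_ontoS] and [fps_pow_expx_sub1_rec],
    with the same initial values. *)
Lemma card_words_onto n A :
  (#|words_onto n A|%:R =
   n`!%:R * fps_pow (fps_sub fps_expx fps_one) #|A| n :> rat)%R.
Proof.
elim: n A => [|n IH] A.
  rewrite fact0 mul1r; have [->|A_neq0] := eqVneq A set0.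
    rewrite cards0 /= (_ : words_onto 0 set0 = setT) ?cardsT ?card_tuple//.
    by apply/setP => t; rewrite !inE tuple0; apply/eqP/setP => x; rewrite !inE.
  rewrite (_ : words_onto 0 A = set0) ?cards0; last first.
    apply/setP => t; rewrite !inE tuple0; apply/negbTE; apply: contraNneq A_neq0 => <-.
    by apply/eqP/setP => x; rewrite !inE.
  have := A_neq0; rewrite -card_gt0; case: #|A| => // k _ /=.
  (* The constant coefficient of e^x - 1 is 1 - 1 = 0. *)
  by rewrite /fps_mul big_ord_recl big_ord0 /fps_sub /fps_expx /fps_one /= invr1 subrr mul0r.
rewrite card_words_ontoS natr_sum.
case cA: #|A| => [|k].
  by move/cards0_eq: cA => ->; rewrite big_set0 /= /fps_one mulr0.
rewrite (eq_bigr (fun=> n`!%:R * (fps_pow (fps_sub fps_expx fps_one) k.+1 n +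
   fps_pow (fps_sub fps_expx fps_one) k n)))%R; last first.
  move=> x xA; have cAx : #|A :\ x| = k by move: cA; rewrite (cardsD1 x A) xA => -[].
  by rewrite natrD !IH cA cAx mulrDr.
rewrite sumr_const cA factS natrM mulrAC fps_pow_expx_sub1_rec.
by rewrite -[LHS]mulr_natl; ring.
Qed.

End Words.

(** * From words to unit interval parking functions *)

Section Standardization.
Variables (n k : nat).
Implicit Types (i j : 'I_n) (f : n.-tuple 'I_k) (p : n.-tuple 'I_n).

Definition std_lt f : rel 'I_n :=
  fun i j => (tnth f i < tnth f j) || (tnth f i == tnth f j) && (i < j).

Lemma std_lt_irr f : irreflexive (std_lt f).
Proof. by move=> i; rewrite /std_lt !ltnn andbF. Qed.

Lemma std_lt_trans f : transitive (std_lt f).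
Proof. by move=> j i l; rewrite /std_lt -!val_eqE /=; lia. Qed.

Lemma std_lt_total f i j : [|| i == j, std_lt f i j | std_lt f j i].
Proof. by rewrite /std_lt -!val_eqE /=; lia. Qed.

Lemma std_rank_subproof f i : #|[set j | std_lt f j i]| < n.
Proof.
rewrite -[X in _ < X]card_ord -cardsT; apply: proper_card; apply/properP.
by split; [apply: subsetT | exists i; rewrite // inE std_lt_irr].
Qed.

(** The standardization of [f], with ranks counted from 0; it is the outcome of [word_upf f]. *)
Definition std_rank f i : 'I_n := Ordinal (std_rank_subproof f i).

Lemma std_rank_lt f i j : (std_rank f i < std_rank f j) = std_lt f i j.
Proof.
have homo a b : std_lt f a b -> std_rank f a < std_rank f b.
  move=> ab; apply: proper_card; apply/properP; split.
    by apply/subsetP => c; rewrite !inE => ca; apply: std_lt_trans ca ab.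
  by exists a; rewrite !inE ?std_lt_irr.
apply/idP/idP => [|/homo//]; case/or3P: (std_lt_total f i j) => [/eqP->||/homo] //.
  by rewrite ltnn.
by move=> /ltnW; rewrite leqNgt => /negbTE->.
Qed.

Lemma std_rank_inj f : injective (std_rank f).
Proof.
move=> i j eq_ij; apply/eqP.
by case/or3P: (std_lt_total f i j) => //; rewrite -std_rank_lt eq_ij ltnn.
Qed.

(** Cars with equal letters form a block; its first car turns out to be its lucky one, by
    [lucky_word_upf]. *)
Definition block_first f i : bool :=
  [forall j, (tnth f j == tnth f i) ==> (i <= j)].

Lemma block_firstP f i :
  reflect (forall j, tnth f j = tnth f i -> i <= j) (block_first f i).
Proof.
apply: (iffP forallP) => ifst j; last by apply/implyP => /eqP; apply: ifst.
by move/eqP=> fji; move/implyP: (ifst j); apply.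
Qed.

Lemma block_first_inj f : {in block_first f &, injective (tnth f)}.
Proof.
move=> i j /block_firstP ifst /block_firstP jfst fij.
by apply: val_inj; apply/eqP; rewrite eqn_leq ifst ?jfst.
Qed.

Lemma exists_block_first f i : exists2 j, block_first f j & tnth f j = tnth f i.
Proof.
have [|j /eqP fji minj] :=
  @arg_minnP _ i [pred j | tnth f j == tnth f i] (@nat_of_ord n).
  by rewrite /= eqxx.
by exists j => //; apply/block_firstP => l flj; apply: minj; rewrite /= flj fji.
Qed.

Lemma std_rank_nonfirst f i : ~~ block_first f i ->
  exists2 j : 'I_n, j < i & std_rank f i = (std_rank f j).+1 :> nat.
Proof.
move=> nfst; have /existsP[j0 /andP[fj0 lt_j0]] :
    [exists j : 'I_n, (tnth f j == tnth f i) && (j < i)].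
  move: nfst; rewrite negb_forall => /existsP[j].
  by rewrite negb_imply -ltnNge => jP; apply/existsP; exists j.
(* The witness is the latest earlier car of the same block, which immediately precedes [i] for
   [std_lt]. *)
have [|j /andP[/eqP fj lt_j] maxj] :=
  @arg_maxnP _ j0 [pred j : 'I_n | (tnth f j == tnth f i) && (j < i)] (@nat_of_ord n).
  by rewrite /= fj0.
have jE l : std_lt f l i = (l == j) || std_lt f l j.
  have := maxj l; rewrite /= /std_lt -!fj -!val_eqE /=.
  have [->|] := eqVneq l j; first by rewrite !eqxx lt_j orbT.
  by rewrite -val_eqE /=; lia.
exists j => //; rewrite /= (cardsD1 j) inE jE eqxx /= add1n; congr _.+1.
by apply: eq_card => l; rewrite !inE jE; case: eqP => // ->; rewrite std_lt_irr.
Qed.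

(** The predecessor is never truncated: by [std_rank_nonfirst], a car that is not first in its block
    has positive rank. *)
Definition word_pref f i : 'I_n :=
  if block_first f i then std_rank f i
  else Ordinal (leq_ltn_trans (leq_pred _) (ltn_ord (std_rank f i))).

Definition word_upf f : n.-tuple 'I_n := [tuple word_pref f i | i < n].

Lemma val_word_upf f i : tnth (word_upf f) i =
  (if block_first f i then nat_of_ord (std_rank f i) else (std_rank f i).-1) :> nat.
Proof. by rewrite tnth_mktuple /word_pref; case: ifP. Qed.

Lemma word_upf_outcome f : unit_outcome (word_upf f) (std_rank f).
Proof.
split=> [|i]; first exact: std_rank_inj.
have := val_word_upf f i; case: ifPn => [_ rankE | /std_rank_nonfirst[j lt_ji ->] prefE].
  by left; apply: val_inj.
by right; split; [rewrite prefE | exists j => //; apply: val_inj].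
Qed.

Lemma lucky_word_upf f : lucky (word_upf f) =1 block_first f.
Proof.
move=> i; rewrite (unit_outcome_lucky (word_upf_outcome f)) -val_eqE.
rewrite [X in _ == X]val_word_upf; case: ifPn => [_|/std_rank_nonfirst[j _ rankE]].
  by rewrite eqxx.
by apply/eqP; move: rankE; rewrite /=; lia.
Qed.

Lemma words_onto_setT f :
  (f \in words_onto n [set: 'I_k]) = [forall v, v \in f].
Proof.
rewrite inE; apply/eqP/forallP => [/setP fT v|fT].
  by have := fT v; rewrite !inE.
by apply/setP => v; rewrite !inE fT.
Qed.

(** When all letters occur, sending the first car of a block to its letter is a bijection onto the
    alphabet. *)
Lemma card_block_first_lt f m : f \in words_onto n [set: 'I_k] -> m <= k ->
  #|[set j | block_first f j & tnth f j < m]| = m.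
Proof.
rewrite words_onto_setT => /forallP f_onto le_mk.
rewrite -(@card_in_imset _ _ (tnth f)); last first.
  by move=> a b; rewrite !inE => /andP[afst _] /andP[bfst _]; apply: block_first_inj.
have -> : tnth f @: [set j | block_first f j & tnth f j < m]
    = [set v : 'I_k | v < m].
  apply/setP => v; rewrite inE; apply/imsetP/idP => [[j]|lt_v].
    by rewrite inE => /andP[_ lt_j] ->.
  have /tnthP[j fj] := f_onto v.
  have [l lfst fl] := exists_block_first f j.
  by exists l; rewrite ?inE ?lfst fl -fj.
by rewrite cardsE -sum1_card -(big_ord_widen k (fun=> 1)) // sum1_card card_ord.
Qed.

(* The block of car i is recovered from the preference by counting the lucky
   cars parked at or before the spot of i. *)
Lemma card_block_first_le_rank f i : f \in words_onto n [set: 'I_k] ->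
  #|[set j | block_first f j & std_rank f j <= std_rank f i]| = (tnth f i).+1.
Proof.
move=> f_onto; rewrite -(card_block_first_lt f_onto (ltn_ord (tnth f i))).
apply: eq_card => j; rewrite !inE ltnS; apply/andb_id2l => /block_firstP jfst.
rewrite leqNgt std_rank_lt /std_lt negb_or -leqNgt.
case: (eqVneq (tnth f i) (tnth f j)) => [fij|_]; last by rewrite andbT.
by rewrite -leqNgt jfst ?andbT.
Qed.

Lemma nb_lucky_word_upf f : f \in words_onto n [set: 'I_k] ->
  nb_lucky (word_upf f) = k.
Proof.
move=> f_onto; rewrite -[RHS](card_block_first_lt f_onto (leqnn k)).
by apply: eq_card => j; rewrite !inE lucky_word_upf ltn_ord andbT.
Qed.

(** The preference determines the outcome and the lucky cars, and these determine each letter by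
    [card_block_first_le_rank]. *)
Lemma word_upf_inj : {in words_onto n [set: 'I_k] &, injective word_upf}.
Proof.
move=> f g f_onto g_onto eq_fg.
have eq_rank i : std_rank f i = std_rank g i.
  apply: Some_inj; rewrite -(unit_outcome_spot (word_upf_outcome f)) eq_fg.
  exact: unit_outcome_spot (word_upf_outcome g) i.
apply: eq_from_tnth => i; apply/val_inj/succn_inj.
rewrite -!card_block_first_le_rank//; apply: eq_card => j.
by rewrite !inE -!lucky_word_upf eq_fg !eq_rank.
Qed.

End Standardization.

(** * From unit interval parking functions to words *)

Section LuckyBlocks.
Variables (n : nat) (p : n.-tuple 'I_n) (sigma : 'I_n -> 'I_n).
Hypothesis out : unit_outcome p sigma.
Implicit Types i j : 'I_n.

(** Its cardinality is the number of the block of car [i], counted from 1 along the street. *)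
Definition lucky_upto i : {set 'I_n} :=
  [set j | lucky p j & sigma j <= sigma i].

Lemma unlucky_prev i : ~~ lucky p i ->
  exists2 j : 'I_n, j < i & sigma i = (sigma j).+1 :> nat.
Proof.
rewrite (unit_outcome_lucky out) => unl.
case: (out.2 i) => [si|[si [j lt_ji sj]]]; first by rewrite si eqxx in unl.
by exists j; rewrite // si sj.
Qed.

(** Walking back along the street from an unlucky car must reach a lucky one, as spots decrease. *)
Lemma lucky_upto_gt0 i : 0 < #|lucky_upto i|.
Proof.
have [m] := ubnP (sigma i); elim: m i => // m IH i le_m.
have [li|/unlucky_prev[j _ sij]] := boolP (lucky p i).
  by apply/card_gt0P; exists i; rewrite inE li leqnn.
apply: leq_trans (IH j _) _; first by rewrite -ltnS -sij.
apply/subset_leq_card/subsetP => l; rewrite !inE sij => /andP[-> /=].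
exact: leqW.
Qed.

Lemma lucky_upto_homo i j : sigma i <= sigma j -> #|lucky_upto i| <= #|lucky_upto j|.
Proof.
move=> le_ij; apply/subset_leq_card/subsetP => l; rewrite !inE => /andP[-> /=].
by move=> /leq_trans; apply.
Qed.

Lemma lucky_upto_lt i j : lucky p j -> sigma i < sigma j ->
  #|lucky_upto i| < #|lucky_upto j|.
Proof.
move=> lj lt_ij; apply/proper_card/properP; split.
  apply/subsetP => l; rewrite !inE => /andP[-> /=].
  by move=> le_l; apply: leq_trans le_l (ltnW lt_ij).
by exists j; rewrite !inE lj /= ?leqnn// -ltnNge.
Qed.

Lemma lucky_upto_le i : #|lucky_upto i| <= nb_lucky p.
Proof. by apply/subset_leq_card/subsetP => l; rewrite !inE => /andP[]. Qed.

(* Between two cars of the same block all cars are unlucky, and an unlucky car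
   arrives after the car parked just before it. *)
Lemma same_block_ltn i j :
  sigma i < sigma j -> #|lucky_upto i| = #|lucky_upto j| -> i < j.
Proof.
have [m] := ubnP (sigma j); elim: m j => // m IH j le_m lt_ij eq_ij.
have [lj|/unlucky_prev[l lt_lj slj]] := boolP (lucky p j).
  by have := lucky_upto_lt lj lt_ij; rewrite eq_ij ltnn.
move: lt_ij; rewrite slj ltnS leq_eqVlt => /predU1P[/val_inj/out.1-> //|lt_il].
apply: ltn_trans lt_lj; apply: IH => //; first by rewrite -ltnS -slj.
apply/eqP; rewrite eqn_leq lucky_upto_homo ?(ltnW lt_il)//= eq_ij.
by apply: lucky_upto_homo; rewrite slj.
Qed.

Lemma exists_word_upf : 0 < nb_lucky p ->
  exists2 f, f \in words_onto n [set: 'I_(nb_lucky p)] & word_upf f = p.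
Proof.
move=> k_gt0.
have blockP i : #|lucky_upto i|.-1 < nb_lucky p.
  by rewrite prednK ?lucky_upto_gt0 ?lucky_upto_le.
(* Letters are block numbers shifted to start from 0. *)
pose f := [tuple Ordinal (blockP i) | i < n].
have fE i : tnth f i = #|lucky_upto i|.-1 :> nat by rewrite tnth_mktuple.
have f_eq i j : tnth f i = tnth f j <-> #|lucky_upto i| = #|lucky_upto j|.
  split=> [/(congr1 val)/=|eq_ij]; last by apply: val_inj; rewrite /= !fE eq_ij.
  by rewrite !fE => /(congr1 succn); rewrite !prednK ?lucky_upto_gt0.
have ltE i j : (sigma i < sigma j) = std_lt f i j.
  have homo a b : sigma a < sigma b -> std_lt f a b.
    move=> lt_ab; rewrite /std_lt; case: ltngtP => //=.
      rewrite !fE; have := lucky_upto_homo (ltnW lt_ab).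
      by have := lucky_upto_gt0 a; lia.
    by move=> /val_inj fab; rewrite fab eqxx; apply: same_block_ltn => //; apply/f_eq.
  apply/idP/idP => [/homo//|ij]; case: ltngtP => // [/homo ji|/val_inj/out.1 eij].
    by have := std_lt_trans ij ji; rewrite std_lt_irr.
  by rewrite eij std_lt_irr in ij.
have rankE i : std_rank f i = sigma i.
  apply: val_inj; rewrite /= (_ : [set j | _] = sigma @^-1: [set v : 'I_n | v < sigma i]).
    rewrite card_preimset; last exact: out.1.
    rewrite cardsE -sum1_card -(big_ord_widen n (fun=> 1)) ?(ltnW (ltn_ord _))//.
    by rewrite sum1_card card_ord.
  by apply/setP => j; rewrite !inE ltE.
have firstE i : block_first f i = lucky p i.
  apply/block_firstP/idP => [ifst|li j /f_eq eq_ji].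
    apply/negPn/negP => unl; have [j lt_ji sij] := unlucky_prev unl.
    (* No lucky car parks in the spot of [i], so [j], one spot before, lies in the same block yet
       arrives earlier. *)
    have := ifst j; rewrite leqNgt lt_ji => /(_ _)/notF; apply; apply/f_eq.
    apply: eq_card => l; rewrite !inE sij; apply/andb_id2l => ll.
    rewrite [RHS]leq_eqVlt ltnS; case: eqP => // sl.
    by have /out.1 li : sigma l = sigma i; [apply: val_inj; rewrite /= sl | rewrite -li ll in unl].
  rewrite leqNgt; apply/negP => lt_ji.
  have : std_lt f j i by rewrite /std_lt (f_eq j i).2// eqxx lt_ji orbT.
  by rewrite -ltE => /(lucky_upto_lt li); rewrite eq_ji ltnn.
exists f.
  rewrite words_onto_setT; apply/forallP => v.
  have : v \in tnth f @: [set i | lucky p i].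
    (* Surjectivity by counting: lucky cars are first in their blocks, so they carry [nb_lucky p]
       distinct letters. *)
    suff -> : tnth f @: [set i | lucky p i] = setT by rewrite inE.
    apply/eqP; rewrite eqEcard subsetT /= cardsT card_ord card_in_imset.
      by apply/subset_leq_card/subsetP => i; rewrite !inE.
    by move=> i j; rewrite !inE -!firstE; apply: block_first_inj.
  by case/imsetP => i _ ->; apply: mem_tnth.
apply: eq_from_tnth => i; apply: val_inj; rewrite [LHS]val_word_upf firstE rankE.
have := unit_outcome_lucky out i; case: ifPn => [_ /esym/eqP-> // | _ /esym/negbT unl].
case: (out.2 i) => [si|[si _]]; first by rewrite si eqxx in unl.
by rewrite si.
Qed.

End LuckyBlocks.

(** * Counting by lucky cars and summing the series *)

Lemma nb_lucky_le n (p : n.-tuple 'I_n) : nb_lucky p <= n.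
Proof. by rewrite -[leqRHS]card_ord; apply: max_card. Qed.

Lemma card_upf_lucky n k : 0 < k ->
  #|[set p : n.-tuple 'I_n | unit_interval_pf p & nb_lucky p == k]| =
  #|words_onto n [set: 'I_k]|.
Proof.
move=> k_gt0; rewrite -(card_in_imset (@word_upf_inj n k)); apply: eq_card => p.
rewrite inE; apply/andP/imsetP => [[/unit_interval_pfP[sigma out] /eqP pk]|].
  case: k / pk k_gt0 => k_gt0; have [f f_onto fp] := exists_word_upf out k_gt0.
  by exists f; rewrite ?fp.
case=> f f_onto ->; split; last by rewrite nb_lucky_word_upf.
by apply/unit_interval_pfP; exists (std_rank f); apply: word_upf_outcome.
Qed.

Lemma fps_pow_expx_sub1E n k : 0 < k ->
  (fps_pow (fps_sub fps_expx fps_one) k n =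
   #|[set p : n.-tuple 'I_n | unit_interval_pf p & nb_lucky p == k]|%:R / n`!%:R)%R.
Proof.
move=> k_gt0; rewrite card_upf_lucky// card_words_onto cardsT card_ord mulrAC.
by rewrite divff ?mul1r// Num.Theory.pnatr_eq0 -lt0n fact_gt0.
Qed.

(** Seen combinatorially: [n] cars cannot include more than [n] lucky ones. *)
Lemma fps_pow_expx_sub1_eq0 n k : n < k ->
  (fps_pow (fps_sub fps_expx fps_one) k n = 0)%R.
Proof.
move=> lt_nk; rewrite fps_pow_expx_sub1E; last exact: leq_ltn_trans lt_nk.
rewrite (_ : [set p | _ & _] = set0) ?cards0 ?mul0r//; apply/setP => p.
by rewrite !inE ltn_eqF ?andbF// (leq_ltn_trans (nb_lucky_le _)).
Qed.

Lemma card_UPF_T1 n (S : set nat) :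
  #|UPF_T1 n S| = \sum_(k < n.+1 | (k : nat) \in S)
    #|[set p : n.-tuple 'I_n | unit_interval_pf p & nb_lucky p == k]|.
Proof.
have lucky_le (p : n.-tuple 'I_n) : nb_lucky p < n.+1 by rewrite ltnS nb_lucky_le.
rewrite -sum1_card (partition_big (fun p => Ordinal (lucky_le p))
  (fun k : 'I_n.+1 => (k : nat) \in S)) /=; last by move=> p; rewrite inE => /andP[].
apply: eq_bigr => k kS; rewrite -sum1_card; apply: eq_bigl => p.
by rewrite !inE -val_eqE /=; case: eqP => [->|]; rewrite ?kS ?andbT ?andbF.
Qed.

Theorem theorem3p6 (S : set nat) (S_pos : forall k : nat, S k -> (0 < k)%N) :
  fps_summable S (fps_pow (fps_sub fps_expx fps_one)) /\
  egf (fun n : nat => #|UPF_T1 n S|)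
    = fps_sum S (fps_pow (fps_sub fps_expx fps_one)).
Proof.
split=> [n|].
  apply: (@sub_finite_set _ _ `I_n.+1) => [k [_ /eqP]|]; last exact: finite_II.
  by rewrite /= ltnS leqNgt; apply: contra => /fps_pow_expx_sub1_eq0->.
apply/funext => n; rewrite /egf /fps_sum card_UPF_T1 natr_sum mulr_suml.
set c := fps_pow _.
rewrite (eq_bigr (fun k : 'I_n.+1 => c k n)) => [|k /set_mem/S_pos k_gt0]; last first.
  by rewrite /c fps_pow_expx_sub1E.
rewrite big_mkcond (fsbig_ord _ _ (fun k => if k \in S then c k n else 0%R)).
(* Extending the sum from indices at most [n] to all of [S] adds only zero coefficients. *)
rewrite -fsbig_mkcondr; apply: fsbig_widen => [k []//|k [Sk /not_andP[|//]]] /=.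
by move/negP; rewrite -leqNgt; apply: fps_pow_expx_sub1_eq0.
Qed.
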